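(* Let $n\ge0$ and let $H_n$ be the pyrene system with $n$ pyrene fragments. Then $$Af(H_n,x)=x^{n}\sum_{l=0}^{2n}\sum_{i=\lceil\frac{l+2n}{4}\rceil}^{n}\sum_{j=\lceil\frac{l}{2}\rceil}^{l}(-1)^{n-i}2^{2i-n}\binom{i}{2i-n}\binom{2i-n}{j}\binom{j}{l-j}x^{l}.$$
   Context: Pyrene system: draw the hexagonal lattice so that every hexagon has two vertical sides; horizontally adjacent hexagons then share a vertical edge. For $n\ge1$, $H_n$ is the hexagonal system (the plane graph formed by the vertices and edges of the following $4n$ hexagons) consisting of a horizontal linear row of $2n$ hexagons $h_{1,1},h_{1,2},\dots,h_{n,1},h_{n,2}$, consecutive ones sharing a vertical edge, together with, for each $i$, a hexagon $s_{i,1}$ directly above and a hexagon $s_{i,2}$ directly below the common edge of $h_{i,1}$ and $h_{i,2}$ (each sharing an edge with both $h_{i,1}$ and $h_{i,2}$). $H_0$ is the null graph (anti-forcing polynomial $1$). For a perfect matching $M$ of $G$, an anti-forcing set of $M$ is a set $S\subseteq E(G)\setminus M$ such that $M$ is the unique perfect matching of $G-S$; the anti-forcing number $af(G,M)$ is the minimum size of an anti-forcing set of $M$. The anti-forcing polynomial is $Af(G,x)=\sum_{M\in\mathcal{M}(G)}x^{af(G,M)}$, where $\mathcal{M}(G)$ is the set of perfect matchings of $G$. Binomial coefficients $\binom{a}{b}$ are $0$ when $b<0$ or $b>a$. *)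

(* Defs.v *)
From mathcomp Require Import all_boot all_order all_algebra.
Set Implicit Arguments. Unset Strict Implicit. Unset Printing Implicit Defensive.
Import GRing.Theory.
Local Open Scope ring_scope.

(* Hexagonal lattice in "brick-wall" coordinates: points of Z x Z.
   The hexagon with lower-left corner (a,b) (a+b even) has the six vertices
   (a+k,b+l), k<3, l<2, and the six edges listed below; its two "vertical
   sides" are (a,b)-(a,b+1) and (a+2,b)-(a+2,b+1).  Horizontally adjacent
   hexagons (a,b),(a+2,b) share the vertical edge at a+2; the hexagon
   (a+1,b+1) (resp. (a+1,b-1)) lies directly above (resp. below) that
   common edge and shares an edge with both. *)
Definition pt := (int * int)%type.

Definition hex_edges (a b : int) : seq (pt * pt) :=
  [:: ((a, b), (a + 1, b)); ((a + 1, b), (a + 2, b));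
      ((a, b + 1), (a + 1, b + 1)); ((a + 1, b + 1), (a + 2, b + 1));
      ((a, b), (a, b + 1)); ((a + 2, b), (a + 2, b + 1))].

(* Lower-left corners of the 4n hexagons of H_n (fragment i = 0..n-1):
   h_{i,1} = (4i,0), h_{i,2} = (4i+2,0), s_{i,1} = (4i+1,1), s_{i,2} = (4i+1,-1). *)
Definition pyrene_hexagons (n : nat) : seq (int * int) :=
  flatten [seq [:: ((4 * i)%N%:Z, 0); ((4 * i + 2)%N%:Z, 0);
                   ((4 * i + 1)%N%:Z, 1); ((4 * i + 1)%N%:Z, -1)] | i <- iota 0 n].

Definition pyrene_edges (n : nat) : seq (pt * pt) :=
  undup (flatten [seq hex_edges h.1 h.2 | h <- pyrene_hexagons n]).

Section Matchings.
Variable E : seq (pt * pt).  (* edge list of a graph without isolated vertices *)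

Definition edge := seq_sub E.

Definition vertices : seq pt := undup (flatten [seq [:: e.1; e.2] | e <- E]).

Definition incident (v : pt) (e : pt * pt) : bool := (e.1 == v) || (e.2 == v).

Definition perfect_matching (M : {set edge}) : bool :=
  all (fun v => #|[set e in M | incident v (val e)]| == 1%N) vertices.

Definition antiforcing (M S : {set edge}) : bool :=
  (S :&: M == set0) &&
  [forall M' : {set edge},
     (perfect_matching M' && (M' :&: S == set0)) ==> (M' == M)].

(* Anti-forcing number: minimum size of an anti-forcing set.  (E \ M is always
   anti-forcing, so the set is nonempty and the default #|E| is never binding.) *)
Definition af (M : {set edge}) : nat :=
  \big[minn/#|{: edge}|]_(S : {set edge} | antiforcing M S) #|S|.

Definition Af : {poly int} :=
  \sum_(M : {set edge} | perfect_matching M) 'X^(af M).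

End Matchings.

(* Main.v *)
Require Import Defs.
From mathcomp Require Import all_boot all_order all_algebra.
From mathcomp Require Import zify ring.
Import GRing.Theory.
Local Open Scope ring_scope.

(** In each half (upper, lower) of a fragment, the three outer vertices leave exactly
    one of the two odd vertices of the adjacent inner row free, and this vertex is
    matched to one of its two neighbours in the row.  Comparing the two halves along the
    vertical edges, a perfect matching of H_n is a word of length n over six letters:
    L (both free vertices matched to the left boundary of the fragment), R (both to the
    right boundary) and M_ab (both to the middle, from the side a above and b below),
    where the only constraint is that R is not followed by L.

    The anti-forcing number is the sum of the letter weights 1 for L and R, 2 for M_ab
    with a <> b, and 3 for M_aa.  An anti-forcing set of this size is chosen fragment by
    fragment.  Conversely, each unit of weight gives an alternating cycle, and distinct
    ones share no edge outside the matching, so every anti-forcing set has at least this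
    size.  Hence P_(n+2) = 2(x + x^2 + x^3) P_(n+1) - x^2 P_n, a Chebyshev recurrence
    solved by x^n sum_k (-1)^k C(n-k,k) (2(1 + x + x^2))^(n-2k). *)

(** Edges of a fragment: [KV] is its left boundary edge, [KM] its middle vertical edge,
    [KA], [KB], [KC], [KD] the inner row from left to right, and [KP], [KQ], [KR], [KS]
    the outer path around the hexagon s; the boolean is [true] in the lower half.  The
    right boundary edge of fragment [i] is [KV] of fragment [i.+1]. *)
Inductive kind : Type :=
  | KV | KM | KA of bool | KB of bool | KC of bool | KD of bool
  | KP of bool | KQ of bool | KR of bool | KS of bool.

Definition kind_x (k : kind) : nat :=
  match k with
  | KV | KA _ => 0 | KB _ | KP _ | KQ _ => 1
  | KM | KC _ | KR _ => 2 | KD _ | KS _ => 3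
  end.

Definition kind_y (k : kind) : int :=
  match k with
  | KV | KM => 0
  | KA s | KB s | KC s | KD s => if s then 0 else 1
  | KP s | KS s => if s then -1 else 1
  | KQ s | KR s => if s then -1 else 2
  end.

Definition kind_vert (k : kind) : bool :=
  match k with KV | KM | KP _ | KS _ => true | _ => false end.

Definition lat_edge (x y : int) (d : bool) : pt * pt :=
  ((x, y), if d then (x, y + 1) else (x + 1, y)).

Definition edge_at (i : nat) (k : kind) : pt * pt :=
  lat_edge (4 * i + kind_x k)%N%:Z (kind_y k) (kind_vert k).

Definition kind_of (c : nat) (y : int) (d : bool) : kind :=
  match c, d with
  | 0, true => KV
  | 0, false => KA (y == 0)
  | 1, true => KP (y == -1)
  | 1, false => if (y == 0) || (y == 1) then KB (y == 0) else KQ (y == -1)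
  | 2, true => KM
  | 2, false => if (y == 0) || (y == 1) then KC (y == 0) else KR (y == -1)
  | _, true => KS (y == -1)
  | _, false => KD (y == 0)
  end.

Definition code_of (e : pt * pt) : nat * kind :=
  let x := `|e.1.1|%N in
  (x %/ 4, kind_of (x %% 4) e.1.2 (e.1.1 == e.2.1))%N.

Lemma edge_atK i k : code_of (edge_at i k) = (i, k).
Proof.
rewrite /code_of /edge_at /lat_edge /=.
have kxlt : (kind_x k < 4)%N by case: k.
have -> : ((4 * i + kind_x k) %/ 4 = i)%N by lia.
have -> : ((4 * i + kind_x k) %% 4 = kind_x k)%N by lia.
have -> : ((4 * i + kind_x k)%N%:Z ==
  (if kind_vert k then ((4 * i + kind_x k)%N%:Z, kind_y k + 1)
   else ((4 * i + kind_x k)%N%:Z + 1, kind_y k)).1) = kind_vert k.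
  by case: (kind_vert k) => /=; lia.
by case: k {kxlt} => // -[].
Qed.

Definition valid_code (n i : nat) (k : kind) : bool :=
  (i < n)%N || [&& i == n, (0 < n)%N & if k is KV then true else false].

Lemma mem_pyrene_edges n e :
  e \in pyrene_edges n -> exists i k, valid_code n i k /\ e = edge_at i k.
Proof.
rewrite mem_undup => /flatten_mapP[h /flatten_mapP[i]].
rewrite mem_iota add0n leq0n /= => lin.
have V k : valid_code n i k by rewrite /valid_code lin.
have W : valid_code n i.+1 KV by rewrite /valid_code; lia.
have main i' k x y d : valid_code n i' k -> x = (4 * i' + kind_x k)%N%:Z -> y = kind_y k ->
    d = kind_vert k -> exists i k, valid_code n i k /\ lat_edge x y d = edge_at i k.
  by move=> Vk -> -> ->; exists i', k.
have hz x y x' : x' = x + 1 -> ((x, y), (x', y)) = lat_edge x y false by move=> ->.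
have vt x y y' : y' = y + 1 -> ((x, y), (x, y')) = lat_edge x y true by move=> ->.
rewrite !inE => /or4P[] /eqP -> /=
   => /or4P[||| /or3P[]] /eqP ->;
   (rewrite hz; last lia) || (rewrite vt; last lia).
- by apply: (main i (KA true)) => //=; lia.
- by apply: (main i (KB true)) => //=; lia.
- by apply: (main i (KA false)) => //=; lia.
- by apply: (main i (KB false)) => //=; lia.
- by apply: (main i KV) => //=; lia.
- by apply: (main i KM) => //=; lia.
- by apply: (main i (KC true)) => //=; lia.
- by apply: (main i (KD true)) => //=; lia.
- by apply: (main i (KC false)) => //=; lia.
- by apply: (main i (KD false)) => //=; lia.
- by apply: (main i KM) => //=; lia.
- by apply: (main i.+1 KV) => //=; lia.
- by apply: (main i (KB false)) => //=; lia.
- by apply: (main i (KC false)) => //=; lia.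
- by apply: (main i (KQ false)) => //=; lia.
- by apply: (main i (KR false)) => //=; lia.
- by apply: (main i (KP false)) => //=; lia.
- by apply: (main i (KS false)) => //=; lia.
- by apply: (main i (KQ true)) => //=; lia.
- by apply: (main i (KR true)) => //=; lia.
- by apply: (main i (KB true)) => //=; lia.
- by apply: (main i (KC true)) => //=; lia.
- by apply: (main i (KP true)) => //=; lia.
- by apply: (main i (KS true)) => //=; lia.
Qed.

Lemma edge_at_in n i k : valid_code n i k -> edge_at i k \in pyrene_edges n.
Proof.
move=> Vk; rewrite mem_undup; apply/flatten_mapP.
have main j x y : (j < n)%N ->
   (x, y) \in [:: ((4 * j)%N%:Z, 0); ((4 * j + 2)%N%:Z, 0);
                   ((4 * j + 1)%N%:Z, 1); ((4 * j + 1)%N%:Z, -1)] ->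
   edge_at i k \in hex_edges x y ->
   exists2 h, h \in pyrene_hexagons n & edge_at i k \in hex_edges h.1 h.2.
  move=> ltjn hj ek; exists (x, y) => //; apply/flatten_mapP; exists j => //.
  by rewrite mem_iota.
case/orP: Vk => [ltin|/and3P[/eqP in_ n0 Vk]]; last first.
  subst i; case: k main Vk => // main _; apply: (main n.-1 (4 * n.-1 + 2)%N%:Z 0).
  - by lia.
  - by rewrite !inE eqxx orbT.
  by rewrite /edge_at /lat_edge /= !inE !xpair_eqE; lia.
have H1 := main i (4 * i)%N%:Z 0 ltin.
have H2 := main i (4 * i + 2)%N%:Z 0 ltin.
have H3 := main i (4 * i + 1)%N%:Z 1 ltin.
have H4 := main i (4 * i + 1)%N%:Z (-1) ltin.
case: k {main} H1 H2 H3 H4 => [||[]|[]|[]|[]|[]|[]|[]|[]] H1 H2 H3 H4;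
 by [ apply: H1; [by rewrite !inE eqxx|]; rewrite /edge_at /lat_edge /= !inE !xpair_eqE; lia
  | apply: H2; [by rewrite !inE eqxx ?orbT|]; rewrite /edge_at /lat_edge /= !inE !xpair_eqE; lia
  | apply: H3; [by rewrite !inE eqxx ?orbT|]; rewrite /edge_at /lat_edge /= !inE !xpair_eqE; lia
  | apply: H4; [by rewrite !inE eqxx ?orbT|]; rewrite /edge_at /lat_edge /= !inE !xpair_eqE;
    lia].
Qed.

Lemma edge_atP n e : reflect (exists i k, valid_code n i k /\ e =
  edge_at i k) (e \in pyrene_edges n).
Proof.
apply: (iffP idP); first exact: mem_pyrene_edges.
by case=> i [k [Vk ->]]; apply: edge_at_in.
Qed.

Definition inM {E : seq (pt * pt)} (M : {set edge E}) (e : pt * pt) : bool :=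
  e \in [seq val x | x <- enum M].

Lemma inM_val E (M : {set edge E}) x : inM M (val x) = (x \in M).
Proof. by rewrite /inM (mem_map val_inj) mem_enum. Qed.

Lemma inM_sub E (M : {set edge E}) e : inM M e -> e \in E.
Proof. by case/mapP => x _ ->; apply: valP. Qed.

Lemma card_incident E (M : {set edge E}) v (L : seq (pt * pt)) :
  uniq L -> (forall e, e \in E -> incident v e = (e \in L)) ->
  #|[set e in M | incident v (val e)]| = count (inM M) L.
Proof.
move=> uL HL; rewrite -size_filter cardE -(size_map val).
apply/perm_size/uniq_perm.
- by rewrite (map_inj_uniq val_inj) enum_uniq.
- exact: filter_uniq.
move=> e; rewrite mem_filter; apply/mapP/andP.
  case=> x; rewrite mem_enum inE => /andP[xM xv] ->.
  by rewrite inM_val -HL //; apply: valP.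
case=> /[dup] /inM_sub eE /mapP[x]; rewrite mem_enum => xM -> xL.
exists x => //; rewrite mem_enum inE xM HL //; exact: valP.
Qed.

Definition star (v : pt) : seq (pt * pt) :=
  [:: lat_edge v.1 v.2 false; lat_edge (v.1 - 1) v.2 false;
      lat_edge v.1 v.2 true; lat_edge v.1 (v.2 - 1) true].

Lemma deg_pyrene n (M : {set edge (pyrene_edges n)}) v :
  #|[set e in M | incident v (val e)]| = count (inM M) (star v).
Proof.
apply: card_incident.
  by rewrite /= !inE !xpair_eqE /=; lia.
move=> e /edge_atP[i [k [_ ->]]]; case: v => x y.
rewrite /edge_at /incident /star !inE /lat_edge /=.
by case: (kind_vert k); rewrite !xpair_eqE /=; lia.
Qed.

Definition prevD (f : nat -> kind -> bool) i s := if i is j.+1 then f j (KD s) else false.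

Definition frag_ok (f : nat -> kind -> bool) i s :=
  [/\ f i (KA s) + f i (KB s) + f i (KP s) = 1,
      f i (KP s) + f i (KQ s) = 1, f i (KQ s) + f i (KR s) = 1,
      f i (KR s) + f i (KS s) = 1 &
      f i (KS s) + f i (KC s) + f i (KD s) = 1 /\
      f i (KB s) + f i (KC s) + f i KM = 1]%N.

Definition bdry_ok (f : nat -> kind -> bool) i s :=
  (f i KV + f i (KA s) + prevD f i s = 1)%N.

Definition frag_vertex (c : nat) (y : int) i := ((4 * i + c)%N%:Z, y) : pt.
Section LocalConditions.
Variable n : nat.
Variable M : {set edge (pyrene_edges n)}.
Let f i k := inM M (edge_at i k).

Lemma inM_lat x y d i k :
  x = (4 * i + kind_x k)%N%:Z -> y = kind_y k -> d = kind_vert k -> inM M (lat_edge x y d) =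
    f i k.
Proof. by move=> -> -> ->. Qed.

Lemma inM_latF x y d :
  (forall i k, x = (4 * i + kind_x k)%N%:Z -> y = kind_y k -> d = kind_vert k -> False) ->
  inM M (lat_edge x y d) = false.
Proof.
move=> H; apply/negP => /inM_sub /edge_atP[i [k [_]]].
rewrite /edge_at /lat_edge => -[] /= xE yE; case: d H => H E; apply: (H i k) => //;
  by move: E; case: kind_vert => // -[]; lia.
Qed.

Lemma inM_valid i k : f i k -> valid_code n i k.
Proof. by move=> /inM_sub /edge_atP[i' [k' [Vk /(congr1 code_of)]]];
  rewrite !edge_atK => -[-> ->]. Qed.

Lemma valid_vertices i k : valid_code n i k ->
  (((4 * i + kind_x k)%N%:Z, kind_y k) \in vertices (pyrene_edges n)) *
  ((if kind_vert k then ((4 * i + kind_x k)%N%:Z, kind_y k + 1) else ((4 * i + kind_x k)%N%:Z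
    + 1, kind_y k))
      \in vertices (pyrene_edges n)).
Proof.
by move=> /edge_at_in ek; split; rewrite mem_undup; apply/flatten_mapP;
  exists (edge_at i k) => //;
   rewrite !inE eqxx ?orbT.
Qed.

Let deg v := count (inM M) (star v).

Lemma deg_inner0 i s : deg (frag_vertex 0 (if s then 0 else 1) i) =
  (f i KV + f i (KA s) + prevD f i s)%N.
Proof.
rewrite /deg /= (@inM_lat _ _ _ i (KA s)) //.
have -> : inM M (lat_edge ((4 * i + 0)%N%:Z - 1) (if s then 0 else 1) false) = prevD f i s.
  case: i => [|i]; last by apply: (@inM_lat _ _ _ i (KD s)) => //=; lia.
  by apply: inM_latF => i k; lia.
case: s => /=.
  rewrite (@inM_lat _ _ _ i KV) // (@inM_latF _ (0 - 1)); first lia.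
  by move=> j [||[]|[]|[]|[]|[]|[]|[]|[]] //=; lia.
rewrite (@inM_lat _ (1 - 1) _ i KV) // (@inM_latF _ 1); first lia.
by move=> j [||[]|[]|[]|[]|[]|[]|[]|[]] //=; lia.
Qed.

Lemma deg_inner1 i s : deg (frag_vertex 1 (if s then 0 else 1) i)
  = (f i (KA s) + f i (KB s) + f i (KP s))%N.
Proof.
rewrite /deg /= (@inM_lat _ _ _ i (KB s)) // (@inM_lat (_ - 1) _ _ i (KA s)) //=; last lia.
case: s => /=.
  rewrite (@inM_lat _ (0 - 1) _ i (KP true)) // (@inM_latF _ 0); first lia.
  by move=> j [||[]|[]|[]|[]|[]|[]|[]|[]] //=; lia.
rewrite (@inM_lat _ 1 _ i (KP false)) // (@inM_latF _ (1 - 1)); first lia.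
by move=> j [||[]|[]|[]|[]|[]|[]|[]|[]] //=; lia.
Qed.

Lemma deg_inner2 i s : deg (frag_vertex 2 (if s then 0 else 1) i)
  = (f i (KB s) + f i (KC s) + f i KM)%N.
Proof.
rewrite /deg /= (@inM_lat _ _ _ i (KC s)) // (@inM_lat (_ - 1) _ _ i (KB s)) //=; last lia.
case: s => /=.
  rewrite (@inM_lat _ 0 _ i KM) // (@inM_latF _ (0 - 1)); first lia.
  by move=> j [||[]|[]|[]|[]|[]|[]|[]|[]] //=; lia.
rewrite (@inM_lat _ (1 - 1) _ i KM) // (@inM_latF _ 1); first lia.
by move=> j [||[]|[]|[]|[]|[]|[]|[]|[]] //=; lia.
Qed.

Lemma deg_inner3 i s : deg (frag_vertex 3 (if s then 0 else 1) i)
  = (f i (KS s) + f i (KC s) + f i (KD s))%N.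
Proof.
rewrite /deg /= (@inM_lat _ _ _ i (KD s)) // (@inM_lat (_ - 1) _ _ i (KC s)) //=; last lia.
case: s => /=.
  rewrite (@inM_lat _ (0 - 1) _ i (KS true)) // (@inM_latF _ 0); first lia.
  by move=> j [||[]|[]|[]|[]|[]|[]|[]|[]] //=; lia.
rewrite (@inM_lat _ 1 _ i (KS false)) // (@inM_latF _ (1 - 1)); first lia.
by move=> j [||[]|[]|[]|[]|[]|[]|[]|[]] //=; lia.
Qed.

Lemma deg_outer1 i s : deg (frag_vertex 1 (if s then -1 else 2) i) =
  (f i (KP s) + f i (KQ s))%N.
Proof.
rewrite /deg /= (@inM_lat _ _ _ i (KQ s)) // (@inM_latF (_ - 1)); last first.
  by case: s => j [||[]|[]|[]|[]|[]|[]|[]|[]] //=; lia.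
case: s => /=.
  rewrite (@inM_lat _ (-1) _ i (KP true)) // (@inM_latF _ (-1-1)); first lia.
  by move=> j [||[]|[]|[]|[]|[]|[]|[]|[]] //=; lia.
rewrite (@inM_lat _ (2 - 1) _ i (KP false)) // (@inM_latF _ 2); first lia.
by move=> j [||[]|[]|[]|[]|[]|[]|[]|[]] //=; lia.
Qed.

Lemma deg_outer2 i s : deg (frag_vertex 2 (if s then -1 else 2) i) =
  (f i (KQ s) + f i (KR s))%N.
Proof.
rewrite /deg /= (@inM_lat _ _ _ i (KR s)) // (@inM_lat (_ - 1) _ _ i (KQ s)) //=; last lia.
rewrite !(@inM_latF _ _ true); first lia.
all: by case: s => j [||[]|[]|[]|[]|[]|[]|[]|[]] //=; lia.
Qed.

Lemma deg_outer3 i s : deg (frag_vertex 3 (if s then -1 else 2)%R i) =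
  (f i (KR s) + f i (KS s))%N.
Proof.
rewrite /deg /= (@inM_lat (_ - 1) _ _ i (KR s)) //=; last lia.
rewrite (@inM_latF _ _ false); last first.
  by case: s => j [||[]|[]|[]|[]|[]|[]|[]|[]] //=; lia.
case: s => /=.
  rewrite (@inM_lat _ (-1) _ i (KS true)) // (@inM_latF _ (-1-1)); first lia.
  by move=> j [||[]|[]|[]|[]|[]|[]|[]|[]] //=; lia.
rewrite (@inM_lat _ (2 - 1) _ i (KS false)) // (@inM_latF _ 2); first lia.
by move=> j [||[]|[]|[]|[]|[]|[]|[]|[]] //=; lia.
Qed.

Lemma perfect_matchingP : reflect
  ((forall i s, (i < n)%N -> frag_ok f i s) /\
   (forall i s, (i <= n)%N -> (0 < n)%N -> bdry_ok f i s))
  (perfect_matching M).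
Proof.
apply: (iffP allP) => [H|[H1 H2] v].
  have {}H v : v \in vertices (pyrene_edges n) -> deg v = 1%N.
    by move=> /H; rewrite deg_pyrene => /eqP.
  split=> i s.
    move=> ltin; have V k : valid_code n i k by rewrite /valid_code ltin.
    split.
    - by rewrite -deg_inner1 H //; case: (valid_vertices _ _ (V (KB s))).
    - by rewrite -deg_outer1 H //; case: (valid_vertices _ _ (V (KQ s))).
    - by rewrite -deg_outer2 H //; case: (valid_vertices _ _ (V (KR s))).
    - rewrite -deg_outer3 H //; case: (valid_vertices _ _ (V (KR s))) => _ /=.
      by rewrite -PoszD -addnA.
    split.
    - by rewrite -deg_inner3 H //; case: (valid_vertices _ _ (V (KD s))).
    - by rewrite -deg_inner2 H //; case: (valid_vertices _ _ (V (KC s))).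
  move=> lein n0; rewrite /bdry_ok -deg_inner0 H //.
  have V : valid_code n i KV by rewrite /valid_code; lia.
  by case: (valid_vertices _ _ V) => /=; case: s.
have {}H2 : (0 < n)%N -> forall i s, (i <= n)%N ->
  deg (frag_vertex 0 (if s then 0 else 1)%R i) = 1%N.
  by move=> n0 i s lein; rewrite deg_inner0; apply: H2.
have {}H1 i s : (i < n)%N ->
  [/\ deg (frag_vertex 1 (if s then 0 else 1)%R i) = 1, 
      deg (frag_vertex 2 (if s then 0 else 1)%R i) = 1, 
      deg (frag_vertex 3 (if s then 0 else 1)%R i) = 1 &
   [/\ deg (frag_vertex 1 (if s then -1 else 2)%R i) = 1, 
      deg (frag_vertex 2 (if s then -1 else 2)%R i) = 1 &
      deg (frag_vertex 3 (if s then -1 else 2)%R i) = 1]]%N.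
  by move=> /(H1 i s)[? ? ? ? []]; rewrite deg_inner1 deg_inner2 deg_inner3 deg_outer1
    deg_outer2 deg_outer3.
rewrite mem_undup deg_pyrene => /flatten_mapP[e /edge_atP[i [k [Vk ->]]]] vE.
apply/eqP; change (deg v = 1%N); case: v vE => x y; rewrite !inE /edge_at /lat_edge.
have n0 : (0 < n)%N by move: Vk; rewrite /valid_code; lia.
case/orP: Vk => [ltin|/and3P[/eqP -> _ ]]; last first.
  case: k => // _ /=; rewrite !xpair_eqE => /orP[]/andP[/eqP -> /eqP ->].
    exact: (H2 n0 n true).
  exact: (H2 n0 n false).
have [H3 H4] := (H1 _ false ltin, H1 _ true ltin).
have [H5 H6] := (H2 n0 _ false (ltnW ltin), H2 n0 _ true (ltnW ltin)).
have [H7 H8] := (H2 n0 _ false ltin, H2 n0 _ true ltin).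
move: H3 H4 => [h1 h2 h3 [h4 h5 h6]] [h1' h2' h3' [h4' h5' h6']].
have hn y' c' : deg (frag_vertex 0 y' i.+1) = 1%N -> c' = 4%N -> deg (frag_vertex c' y' i) =
  1%N.
  by move=> h ->; rewrite -[RHS]h; rewrite /frag_vertex; congr (deg (_%:Z, _)); lia.
have {}H7 := hn _ _ H7 erefl; have {}H8 := hn _ _ H8 erefl.
have fin c y' : deg (frag_vertex c y' i) = 1%N -> x = (4 * i + c)%N -> y = y' -> deg (x, y) =
  1%N.
  by move=> ? -> ->.
case: k => [||[]|[]|[]|[]|[]|[]|[]|[]] /=;
  rewrite !xpair_eqE => /orP[]/andP[/eqP xE /eqP yE];
  by [apply: (fin _ _ H5); lia | apply: (fin _ _ H6); lia |
      apply: (fin _ _ H7); lia | apply: (fin _ _ H8); lia |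
      apply: (fin _ _ h1); lia | apply: (fin _ _ h1'); lia |
      apply: (fin _ _ h2); lia | apply: (fin _ _ h2'); lia |
      apply: (fin _ _ h3); lia | apply: (fin _ _ h3'); lia |
      apply: (fin _ _ h4); lia | apply: (fin _ _ h4'); lia |
      apply: (fin _ _ h5); lia | apply: (fin _ _ h5'); lia |
      apply: (fin _ _ h6); lia | apply: (fin _ _ h6'); lia ].
Qed.

End LocalConditions.

(** * Words *)

(** [inl false] is L, [inl true] is R and [inr (a, b)] is M_ab. *)
Definition letter := (bool + bool * bool)%type.
Definition isL (c : letter) := c == inl false.
Definition isR (c : letter) := c == inl true.
Definition dflt : letter := inr (false, false).

(** The position, left ([false]) or right, of the free odd vertex of the half [s]. *)
Definition side (s : bool) (c : letter) : bool :=
  match c with inl r => r | inr (a, b) => if s then b else a end.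

Definition isM (c : letter) := if c is inr _ then true else false.

Definition prevR (w : nat -> letter) i := if i is j.+1 then isR (w j) else false.

Definition used (w : nat -> letter) (i : nat) (k : kind) : bool :=
  match k with
  | KV => ~~ (prevR w i || isL (w i))
  | KM => ~~ isM (w i)
  | KA _ => isL (w i)
  | KD _ => isR (w i)
  | KB s => isM (w i) && ~~ side s (w i)
  | KC s => isM (w i) && side s (w i)
  | KQ s | KS s => ~~ side s (w i)
  | KP s | KR s => side s (w i)
  end.

Definition word_ok n (w : nat -> letter) :=
  (forall i, isR (w i) -> isL (w i.+1) -> False) /\
  (forall i, (n <= i)%N -> w i = dflt).

Definition wmatch n (w : nat -> letter) : {set edge (pyrene_edges n)} :=
  [set e | used w (code_of (val e)).1 (code_of (val e)).2].

Lemma inM_wmatch n w i k :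
  inM (wmatch n w) (edge_at i k) = valid_code n i k && used w i k.
Proof.
have [Vk|Vk] /= := boolP (valid_code n i k); last first.
  by apply: contraNF Vk; apply: inM_valid.
pose x : edge (pyrene_edges n) := SeqSub (edge_at_in _ _ _ Vk).
by rewrite -[edge_at i k]/(val x) inM_val inE -[val x]/(edge_at i k) edge_atK.
Qed.

Lemma pm_wmatch n w : word_ok n w -> perfect_matching (wmatch n w).
Proof.
case=> okw outw; apply/perfect_matchingP; split=> i s.
  move=> ltin; rewrite /frag_ok !inM_wmatch /valid_code ltin /=.
  by case: (w i) => [[]|[[] []]] //=; case: s.
move=> lein n0; rewrite /bdry_ok !inM_wmatch /=.
have -> : valid_code n i KV by rewrite /valid_code; lia.
have -> : valid_code n i (KA s) && isL (w i) = isL (w i).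
  rewrite /valid_code; case: (ltnP i n) => //= leni.
  by rewrite outw ?leni ?andbF.
have -> : prevD (fun i k => inM (wmatch n w) (edge_at i k)) i s = prevR w i.
  by case: i lein => //= i lein; rewrite inM_wmatch /valid_code lein.
case: i {lein} => [|i] /=; first by case: isL.
by have := okw i; case: isR; case: isL => //= /(_ isT isT).
Qed.

Definition read_letter (f : nat -> kind -> bool) i : letter :=
  if f i (KA false) then inl false else
  if f i (KD false) then inl true else inr (f i (KC false), f i (KC true)).

Definition read_word n (M : {set edge (pyrene_edges n)}) i :=
  read_letter (fun i k => inM M (edge_at i k)) i.

Lemma eq_inM n (M M' : {set edge (pyrene_edges n)}) :
  (forall i k, valid_code n i k -> inM M (edge_at i k) = inM M' (edge_at i k)) -> M = M'.
Proof.
move=> H; apply/setP => x; rewrite -!inM_val.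
have /edge_atP[i [k [Vk ->]]] : val x \in pyrene_edges n by apply: valP.
exact: H.
Qed.

Lemma frag_cases f i s : frag_ok f i s ->
  let t := (f i (KA s), f i (KB s), f i (KC s), f i (KD s), f i KM,
            (f i (KP s), f i (KQ s), f i (KR s), f i (KS s))) in
  [\/ t = (true, false, false, false, true, (false, true, false, true)),
      t = (false, true, false, false, false, (false, true, false, true)),
      t = (false, false, true, false, false, (true, false, true, false)) |
      t = (false, false, false, true, true, (true, false, true, false))].
Proof.
rewrite /frag_ok /=; case: (f i (KQ s)); case: (f i (KP s)); case: (f i (KR s));
case: (f i (KS s)) => -[] //; case: (f i (KA s)); case: (f i (KB s)) => // _ _ _ _ [];
case: (f i (KC s)); case: (f i (KD s)) => // _; case: (f i KM) => // _.
all: by [apply: Or41 | apply: Or42 | apply: Or43 | apply: Or44].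
Qed.

Lemma frag_sym f i :
  frag_ok f i false -> frag_ok f i true -> f i (KA true) = f i (KA false) ->
  f i (KD true) = f i (KD false).
Proof.
by move=> /frag_cases + /frag_cases + =>
  -[] [A1 _ _ D1 m1 _ _ _ _] [] [A2 _ _ D2 m2 _ _ _ _]; rewrite A1 D1 A2 D2;
  rewrite m1 in m2.
Qed.

Lemma read_wordP n (M : {set edge (pyrene_edges n)}) :
  perfect_matching M -> word_ok n (read_word n M) /\ M = wmatch n (read_word n M).
Proof.
move=> /perfect_matchingP; set f := fun i k => _; move=> [frag bdry].
have fE i k : inM M (edge_at i k) = f i k by [].
have readE i : read_word n M i = read_letter f i by [].
have fN i k : (n < i)%N -> f i k = false.
  by move=> ltni; apply/negP => /inM_valid; rewrite /valid_code; lia.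
have fN' k : f n k -> k = KV.
  by move/inM_valid; rewrite /valid_code ltnn eqxx /= => /andP[_]; case: k.
clearbody f.
have fn k : k <> KV -> f n k = false by move=> kV; apply/negP => /fN'.
have out i : (n <= i)%N -> read_word n M i = dflt.
  rewrite leq_eqVlt readE /read_letter => /orP[/eqP <-|/fN H]; last by rewrite !H.
  by rewrite !fn.
have sym i : (i <= n)%N -> (0 < n)%N -> (f i (KA true) = f i (KA false)) /\
    (i < n -> f i (KD true) = f i (KD false))%N.
  elim: i => [|i IH] lein n0.
    have := bdry 0%N false lein n0; have := bdry 0%N true lein n0.
    rewrite /bdry_ok /= => h1 h2; split=> [|lt0]; first lia.
    by apply: frag_sym; [exact: frag|exact: frag|lia].
  have [h3 h4] := IH (ltnW lein) n0; have {}h4 := h4 lein.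
  have := bdry i.+1 false lein n0; have := bdry i.+1 true lein n0.
  rewrite /bdry_ok /= => h1 h2; split=> [|lt0]; first lia.
  by apply: frag_sym; [exact: frag|exact: frag|lia].
have readL i : isL (read_word n M i) = f i (KA false).
  by rewrite readE /read_letter; case: (f i _) => //; case: (f i _).
have readR i : (i < n)%N -> isR (read_word n M i) = f i (KD false).
  move=> /(frag i false)/frag_cases[] [A _ _ D _ _ _ _ _];
  by rewrite readE /read_letter A D.
split; first split=> //.
- move=> i; have [ltin|leni] := ltnP i n; last by rewrite out.
  rewrite readL readR //.
  have := bdry i.+1 false ltin (leq_ltn_trans (leq0n _) ltin).
  by rewrite /bdry_ok /=; lia.
apply: eq_inM => i k Vk; rewrite inM_wmatch Vk /= fE.
have n0 : (0 < n)%N by move: Vk; rewrite /valid_code; lia.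
have prevE : (i <= n)%N -> prevD f i false = prevR (read_word n M) i.
  by case: i {Vk} => //= i ltin; rewrite readR.
have lein : (i <= n)%N by move: Vk; rewrite /valid_code; lia.
have := bdry i false lein n0; rewrite /bdry_ok prevE //.
have [ltin|leni] := ltnP i n; last first.
  have -> : k = KV by move: Vk; rewrite /valid_code; case: k => //; lia.
  by rewrite /= readL; case: (f i KV); case: prevR; case: (f i _).
have [sA /(_ ltin) sD] := sym i (ltnW ltin) n0.
have rE := readE i; rewrite /read_letter in rE.
case/frag_cases: (frag i false ltin) => -[a1 b1 c1 d1 m1 p1 q1 r1 s1];
case/frag_cases: (frag i true ltin) => -[a2 b2 c2 d2 m2 p2 q2 r2 s2];
  rewrite a1 a2 in sA => //; rewrite d1 d2 in sD => //; rewrite m1 in m2 => //;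
  rewrite a1 ?d1 ?c1 ?c2 in rE; rewrite a1 => bE;
case: k {Vk} => [||[]|[]|[]|[]|[]|[]|[]|[]] /=; rewrite ?rE //.
all: by move: bE; case: prevR; case: (f i KV).
Qed.

(** * Anti-forcing numbers *)

Definition weight (c : letter) : nat :=
  match c with inl _ => 1 | inr (a, b) => if a == b then 3 else 2 end.

Lemma read_wmatch n w : word_ok n w -> read_word n (wmatch n w) =1 w.
Proof.
move=> [_ outw] i; rewrite /read_word /read_letter !inM_wmatch /valid_code.
have [ltin|leni] := ltnP i n; last by rewrite /= !andbF outw.
by rewrite /=; case: (w i) => [[]|[[] []]].
Qed.

Lemma eq_wmatch n w w' : w =1 w' -> wmatch n w = wmatch n w'.
Proof.
move=> ww'; apply/setP => e; rewrite !inE; case: code_of => i k /=.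
by have -> : used w i k = used w' i k by case: k => [||?|?|?|?|?|?|?|?]; case: i => [|i] /=;
  rewrite !ww'.
Qed.

Lemma wmatch_inj n w w' : word_ok n w -> word_ok n w' ->
  wmatch n w = wmatch n w' -> w =1 w'.
Proof.
by move=> okw okw' ww' i; rewrite -(read_wmatch _ _ okw) -(read_wmatch _ _ okw') ww'.
Qed.

(** The chosen edges exclude every letter other than M_ab in the fragments where the word
    has M_ab; then the letters L are forced from left to right, and the letters R from
    right to left, because the boundary edge chosen for them must be left unmatched. *)
Definition force_codes (w : nat -> letter) i : seq (nat * kind) :=
  match w i with
  | inl false => [:: (i, KV)]
  | inl true => [:: (i.+1, KV)]
  | inr (a, b) =>
      [:: (i, if a then KQ false else KR false), (i, if b then KQ true else KR true) &
          if a == b then [:: (i, if a then KD false else KA false)] else [::]]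
  end.

Definition force_edges n (w : nat -> letter) : seq (pt * pt) :=
  flatten [seq [seq edge_at p.1 p.2 | p <- force_codes w i] | i <- iota 0 n].

Definition force_set n (w : nat -> letter) : {set edge (pyrene_edges n)} :=
  [set e | val e \in force_edges n w].

Lemma size_force_edges n w : size (force_edges n w) = (\sum_(i < n) weight (w i))%N.
Proof.
rewrite /force_edges size_flatten /shape -map_comp sumnE big_map.
rewrite -(big_mkord xpredT (fun i => weight (w i))) /index_iota subn0.
apply: eq_bigr => i _; rewrite /= size_map /force_codes.
by case: (w i) => [[]|[[] []]].
Qed.

Lemma card_force_set n w : (#|force_set n w| <= \sum_(i < n) weight (w i))%N.
Proof.
rewrite -size_force_edges cardE -(size_map val); apply: uniq_leq_size.
  by rewrite (map_inj_uniq val_inj) enum_uniq.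
by move=> e /mapP[x]; rewrite mem_enum inE => ? ->.
Qed.

Lemma force_setP n w (M : {set edge (pyrene_edges n)}) :
  M :&: force_set n w = set0 <->
  (forall i, (i < n)%N ->
    all (fun e => ~~ inM M e) [seq edge_at p.1 p.2 | p <- force_codes w i]).
Proof.
split=> [H i ltin|H].
  apply/allP => e ei; apply/negP => /mapP[x]; rewrite mem_enum => xM eE.
  have : x \in M :&: force_set n w; last by rewrite H inE.
  rewrite !inE xM /=; apply/flatten_mapP; exists i; first by rewrite mem_iota.
  by rewrite -eE.
apply/setP => x; rewrite !inE; apply/negP => /andP[xM /flatten_mapP[i]].
rewrite mem_iota add0n => /andP[_ /H /allP Hi] /Hi.
by rewrite inM_val xM.
Qed.

Lemma antiforcing_force_set n w : word_ok n w -> antiforcing (wmatch n w) (force_set n w).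
Proof.
move=> okw; apply/andP; split.
  rewrite setIC; apply/eqP/force_setP => i ltin; rewrite /force_codes.
  have := okw.1 i.
  by case wi: (w i) => [[]|[[] []]] /=; rewrite ?inM_wmatch /= ?wi ?andbF ?orbT //= andbF.
apply/forallP => M'; apply/implyP => /andP[/read_wordP[]].
move: (read_word n M') => w' okw' -> /eqP/force_setP H.
apply/eqP/eq_wmatch.
have HM i : (i < n)%N -> isM (w i) -> w' i = w i.
  move=> ltin; have := H i ltin; rewrite /force_codes.
  case wi: (w i) => [//|[a b]] + _.
  have V k : valid_code n i k by rewrite /valid_code ltin.
  by case: a b {wi} => [] [] /=; rewrite !inM_wmatch !V /=;
    case: (w' i) => [[]|[[] []]].
have HL i : (i < n)%N -> isL (w i) -> isL (w' i).
  elim: i => [|i IH] ltin wL.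
    have := H 0%N ltin; rewrite /force_codes (eqP wL) /= inM_wmatch /= /valid_code ltin /=.
    by rewrite andbT negbK.
  have := H i.+1 ltin; rewrite /force_codes (eqP wL) /= inM_wmatch /= /valid_code ltin /=.
  rewrite andbT negbK => /orP[wR|//].
  case wi: (w i) => [[]|[a b]].
  - by case: (okw.1 i); rewrite ?wL // wi.
  - by move: wR; rewrite /isR (eqP (IH (ltnW ltin) _)) // wi.
  by move: wR; rewrite HM ?wi // ltnW.
have HR m i : (i + m = n)%N -> (i < n)%N -> isR (w i) -> isR (w' i).
  elim: m i => [|m IH] i im ltin wR; first by lia.
  have := H i ltin; rewrite /force_codes (eqP wR) /= inM_wmatch /=.
  have -> : valid_code n i.+1 KV by rewrite /valid_code; lia.
  rewrite /= andbT negbK => /orP[//|wL].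
  have [lti1|] := ltnP i.+1 n; last by move=> le; move: wL; rewrite okw'.2.
  case wi: (w i.+1) => [[]|[a b]].
  - have := IH i.+1; rewrite wi addSnnS => /(_ im lti1 isT) /eqP wR'.
    by rewrite wR' in wL.
  - by case: (okw.1 i); rewrite ?wR // wi.
  by move: wL; rewrite HM ?wi.
move=> i; have [ltin|leni] := ltnP i n; last by rewrite okw.2 ?okw'.2.
case wi: (w i) => [[]|[a b]]; last by rewrite HM ?wi.
  by apply/eqP/(HR (n - i)%N); rewrite ?wi //; lia.
by apply/eqP/HL; rewrite ?wi.
Qed.

Definition upd (w : nat -> letter) i c : nat -> letter :=
  fun j => if j == i then c else w j.

Arguments upd : simpl never.

Lemma prevR_upd w i c : prevR (upd w i c) i = prevR w i.
Proof. by case: i => //= i; rewrite /upd ltn_eqF. Qed.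

Lemma prevR_updS w i c : prevR (upd w i.+1 c) i = prevR w i.
Proof. by case: i => //= i; rewrite /upd ltn_eqF. Qed.

Lemma word_ok_upd n w i c : (i < n)%N -> word_ok n w ->
  ~~ (prevR w i && isL c) -> ~~ (isR c && isL (w i.+1)) -> word_ok n (upd w i c).
Proof.
move=> ltin [okw outw] hL hR; split=> j; rewrite /upd; last first.
  by case: eqP => [->|_ /outw //]; lia.
case: eqP => [->|ji]; case: eqP => [e|ji'].
- by lia.
- by move=> cR wL; rewrite cR wL in hR.
- by move=> wR cL; move: hL; rewrite -e /= wR cL.
exact: okw.
Qed.

(** Each new edge of the matching that realises the [t]-th unit of weight of fragment [i]
    has zone [(i, t)], so these matchings have disjoint sets of new edges.  When L is
    blocked in fragment [i] by a preceding R, the pair R M_00 is replaced with M_00 L,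
    which is why some edges of a fragment belong to the zone of a neighbour. *)
Definition zone (w : nat -> letter) (i : nat) (k : kind) : nat * nat :=
  match w i, k with
  | inl false, (KB _ | KV) => (i, 0)
  | inl false, _ => (i.-1, 2)
  | inl true, KC _ => (i, 0)
  | inl true, (KQ _ | KS _ | KB _) => (i.+1, 2)
  | inr _, (KB s | KC s | KP s | KQ s | KR s | KS s) => (i, nat_of_bool s)
  | inr _, (KA _ | KD _ | KM) => (i, 2)
  | _, _ => (i.-1, 0)
  end%N.

Lemma eq_used w w' i k : w i = w' i -> prevR w i = prevR w' i -> used w i k = used w' i k.
Proof. by case: k => [||?|?|?|?|?|?|?|?] /= ww' pp'; rewrite ?ww' ?pp'. Qed.

Lemma zone_upd w i c (z : nat * nat) :
  (forall k, used (upd w i c) i k -> ~~ used w i k -> zone w i k = z) ->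
  (isR (w i) -> ~~ isR c -> ~~ isL (w i.+1) -> zone w i.+1 KV = z) ->
  forall j k, used (upd w i c) j k -> ~~ used w j k -> zone w j k = z.
Proof.
move=> Hi Hi1 j k; have [->|ji] := eqVneq j i; first exact: Hi.
have [->|ji1] := eqVneq j i.+1; last first.
  rewrite (eq_used w (upd w i c)) ?/upd ?(negPf ji) //; first by move=> ->.
  by case: j ji ji1 => //= j _; rewrite eqSS => /negPf ->.
case: k => [||?|?|?|?|?|?|?|?] /=; rewrite /upd ?eqxx gtn_eqF //; try by move=> ->.
rewrite negbK negb_or => /andP[cR wL]; rewrite (negPf wL) orbF => wR.
exact: Hi1.
Qed.

Lemma exists_flip n w i t : word_ok n w -> (i < n)%N -> (t < weight (w i))%N ->
  exists2 w', word_ok n w' & w' i <> w i /\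
    forall j k, used w' j k -> ~~ used w j k -> zone w j k = (i, t).
Proof.
move=> okw ltin; have okwi := okw.1 i.
case wi: (w i) => [[]|[a b]] /=.
- case: t => // _; exists (upd w i (inr (true, true))).
    by apply: word_ok_upd => //; rewrite andbF.
  split; first by rewrite /upd eqxx.
  apply: zone_upd => [k|_ _ wL].
    by case: k => [||?|[]|[]|?|[]|[]|[]|[]] /=;
      rewrite ?prevR_upd ?prevR_updS ?prevR_upd /upd eqxx /zone wi //; case: prevR.
  rewrite /zone; case wi1: (w i.+1) => [[]|p] //.
  by rewrite wi1 in wL.
- case: t => // _; exists (upd w i (inr (false, false))).
    by apply: word_ok_upd => //; rewrite andbF.
  split; first by rewrite /upd eqxx.
  apply: zone_upd => [k|]; last by rewrite wi.
  by case: k => [||?|[]|[]|?|[]|[]|[]|[]] /=;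
    rewrite ?prevR_upd ?prevR_updS ?prevR_upd /upd eqxx /zone wi.
case: t => [_|[_|[|t]]].
- exists (upd w i (inr (~~ a, b))).
    by apply: word_ok_upd => //; rewrite andbF.
  split; first by rewrite /upd eqxx; case: a {wi}.
  apply: zone_upd => [k|]; last by rewrite wi.
  case: k => [||?|[]|[]|?|[]|[]|[]|[]] /=; rewrite ?prevR_upd ?prevR_updS ?prevR_upd /upd
    eqxx /zone wi //=.
  + by case: prevR.
  + by case: b {wi}.
  + by case: b {wi}.
  + by case: b {wi}.
  + by case: b {wi}.
  + by case: b {wi}.
  + by case: b {wi}.
- exists (upd w i (inr (a, ~~ b))).
    by apply: word_ok_upd => //; rewrite andbF.
  split; first by rewrite /upd eqxx; case: b {wi}; case: a.
  apply: zone_upd => [k|]; last by rewrite wi.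
  case: k => [||?|[]|[]|?|[]|[]|[]|[]] /=; rewrite ?prevR_upd ?prevR_updS ?prevR_upd /upd
    eqxx /zone wi //=.
  + by case: prevR.
  + by case: a {wi}.
  + by case: a {wi}.
  + by case: a {wi}.
  + by case: a {wi}.
  + by case: a {wi}.
  + by case: a {wi}.
- case: eqP => // ab _; rewrite -ab in wi; case: a wi {ab} => wi.
  + have [wL|wL] := boolP (isL (w i.+1)); last first.
      exists (upd w i (inl true)); first by apply: word_ok_upd; rewrite ?andbF.
      split; first by rewrite /upd eqxx.
      apply: zone_upd => [k|]; last by rewrite wi.
      case: k => [||?|[]|[]|?|[]|[]|[]|[]] /=; rewrite ?prevR_upd ?prevR_updS ?prevR_upd /upd
        eqxx /zone wi //=.
      by case: prevR.
    have lti1 : (i.+1 < n)%N by rewrite ltnNge; apply/negP => /okw.2 e; rewrite e in wL.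
    exists (upd (upd w i.+1 (inr (true, true))) i (inl true)).
      apply: word_ok_upd; rewrite ?andbF ?/upd ?eqxx //.
      by apply: word_ok_upd; rewrite ?andbF.
    split; first by rewrite /upd eqxx.
    move=> j k; have [->|ji] := eqVneq j i.
      case: k => [||?|[]|[]|?|[]|[]|[]|[]] /=; rewrite ?prevR_upd ?prevR_updS ?prevR_upd /upd
        eqxx /zone wi //=.
      by case: prevR.
    have [->|ji1] := eqVneq j i.+1.
      case: k => [||?|?|?|?|?|?|?|?] /=; rewrite ?prevR_upd ?prevR_updS ?prevR_upd /upd eqxx
        gtn_eqF // /zone (eqP wL) //=.
      by case: ifP.
    rewrite (eq_used _ w); first by move=> ->.
      by rewrite /upd (negPf ji) (negPf ji1).
    case: j ji ji1 => //= j ji; rewrite eqSS /upd => /negPf ->.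
    by case: eqP => // ->; rewrite (eqP wL).
  have [wR|wR] := boolP (prevR w i); last first.
    exists (upd w i (inl false)); first by apply: word_ok_upd; rewrite ?andbT.
    split; first by rewrite /upd eqxx.
    apply: zone_upd => [k|]; last by rewrite wi.
    by case: k => [||?|[]|[]|?|[]|[]|[]|[]] /=;
      rewrite ?prevR_upd ?prevR_updS ?prevR_upd /upd eqxx /zone wi //; case: prevR.
  case: i wR wi ltin okwi => //= i wR wi ltin okwi.
  exists (upd (upd w i (inr (false, false))) i.+1 (inl false)).
    apply: word_ok_upd; rewrite ?andbF //= ?/upd ?eqxx //.
    by apply: word_ok_upd; rewrite ?andbF // ltnW.
  split; first by rewrite /upd eqxx.
  move=> j k; have [->|ji] := eqVneq j i.+1.
    by case: k => [||?|[]|[]|?|[]|[]|[]|[]] /=;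
      rewrite ?prevR_upd ?prevR_updS ?prevR_upd /upd !eqxx /zone wi //; case: (isR _).
  have [->|ji1] := eqVneq j i.
    case: k => [||?|[]|[]|?|[]|[]|[]|[]] /=; rewrite ?prevR_upd ?prevR_updS ?prevR_upd /upd
      eqxx ltn_eqF // /zone (eqP wR) //=.
    by case: prevR.
  rewrite (eq_used _ w); first by move=> ->.
    by rewrite /upd (negPf ji) (negPf ji1).
  case: j ji ji1 => //= j; rewrite eqSS /upd => /negPf -> ji1.
  by case: eqP => // ->; rewrite wi.
by case: (a == b).
Qed.

Lemma antiforcing_ge n w S : word_ok n w -> antiforcing (wmatch n w) S ->
  (\sum_(i < n) weight (w i) <= #|S|)%N.
Proof.
move=> okw /andP[/eqP SM /forallP forceS].
pose T := [seq (i, t) | i <- iota 0 n, t <- iota 0 (weight (w i))].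
have -> : (\sum_(i < n) weight (w i))%N = size T.
  rewrite size_allpairs_dep sumnE big_map.
  rewrite -(big_mkord xpredT (fun i => weight (w i))) /index_iota subn0.
  by apply: eq_bigr => i _; rewrite size_iota.
rewrite cardE -(size_map (fun e => zone w (code_of (val e)).1 (code_of (val e)).2)).
apply: uniq_leq_size.
  by apply: allpairs_uniq_dep => [|i _|]; rewrite ?iota_uniq // => -[? ?] [? ?] _ _ [-> ->].
move=> [i t] /allpairsPdep[i' [t' []]]; rewrite !mem_iota !add0n /= => ltin ltt [-> ->].
have [w' okw' [wi' zw']] := exists_flip _ _ _ _ okw ltin ltt.
have /implyP := forceS (wmatch n w'); rewrite pm_wmatch //=.
have [/eqP dis /(_ isT)/eqP /(wmatch_inj _ _ _ okw' okw)/(_ i') //|/set0Pn[e]] :=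
  boolP (wmatch n w' :&: S == set0).
rewrite inE => /andP[ew' eS] _; apply/mapP; exists e; first by rewrite mem_enum.
have ew : e \notin wmatch n w.
  apply/negP => ew; have : e \in S :&: wmatch n w by rewrite inE eS.
  by rewrite SM inE.
by rewrite -(zw' (code_of (val e)).1 (code_of (val e)).2) //; move: ew' ew; rewrite !inE.
Qed.

Lemma big_minn_eq (I : finType) (P : pred I) (F : I -> nat) d i0 m :
  P i0 -> (F i0 <= m)%N -> (forall i, P i -> m <= F i)%N -> (m <= d)%N ->
  \big[minn/d]_(i | P i) F i = m.
Proof.
move=> Pi0 Fi0 Fm md; apply/eqP; rewrite eqn_leq; apply/andP; split.
  apply: leq_trans Fi0; elim: index_enum (mem_index_enum i0) => // i r IH.
  rewrite inE big_cons => /orP[/eqP <-|/IH le]; first by rewrite Pi0 geq_minl.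
  by case: (P i) => //; rewrite geq_min le orbT.
by elim/big_ind: _ => // x y mx my; rewrite leq_min mx.
Qed.

Lemma af_wmatch n w : word_ok n w -> af (wmatch n w) = (\sum_(i < n) weight (w i))%N.
Proof.
move=> okw; have F := antiforcing_force_set _ _ okw.
apply: (big_minn_eq _ _ _ _ _ _ F); first exact: card_force_set.
  by move=> S; apply: antiforcing_ge.
exact: leq_trans (antiforcing_ge _ _ _ okw F) (max_card _).
Qed.

(** * Counting words *)

Definition noRL (x y : letter) := ~~ (isR x && isL y).

Lemma word_ok_tuple n (t : n.-tuple letter) :
  sorted noRL t -> word_ok n (nth dflt t).
Proof.
move=> /(sortedP dflt) st; split=> i; last by move=> leni; rewrite nth_default ?size_tuple.
have [lt|le] := ltnP i.+1 (size t); last by rewrite [nth _ _ i.+1]nth_default.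
by have := st i lt; rewrite /noRL => /negP H iR iL; apply: H; rewrite iR iL.
Qed.

Lemma sorted_word_ok n w : word_ok n w ->
  sorted noRL [tuple w i | i < n].
Proof.
move=> [okw _]; apply/(sortedP dflt) => i; rewrite size_tuple => lt.
rewrite (nth_mktuple _ _ (Ordinal lt)) (nth_mktuple _ _ (Ordinal (ltnW lt))).
by apply/negP => /andP[/okw].
Qed.

Lemma nth_word_ok n w : word_ok n w -> nth dflt [tuple w i | i < n] =1 w.
Proof.
move=> [_ outw] i; have [lt|le] := ltnP i n; last by rewrite nth_default ?size_tuple ?outw.
exact: (nth_mktuple _ _ (Ordinal lt)).
Qed.

Definition word_weight (s : seq letter) : nat := \sum_(c <- s) weight c.

Lemma Af_words n : Af (pyrene_edges n) =
  \sum_(t : n.-tuple letter | sorted noRL t) 'X^(word_weight t).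
Proof.
rewrite /Af (reindex_onto (fun t : n.-tuple letter => wmatch n (nth dflt t))
   (fun M => [tuple read_word n M i | i < n])) /=; last first.
  move=> M /read_wordP[okM EM]; rewrite [RHS]EM.
  exact/eq_wmatch/nth_word_ok.
apply: eq_big => t; last first.
  case/andP=> /read_wordP[okw _] /eqP tE; rewrite af_wmatch.
    by rewrite /word_weight (big_nth dflt) big_mkord size_tuple.
  by apply: word_ok_tuple; rewrite -tE; apply: sorted_word_ok.
apply/andP/idP => [[/read_wordP[okw _] /eqP <-]|/word_ok_tuple okw].
  exact: sorted_word_ok.
split; first exact: pm_wmatch.
apply/eqP/eq_from_tnth => i; rewrite tnth_mktuple read_wmatch //.
by rewrite (tnth_nth dflt).
Qed.

Definition word_poly n : {poly int} := \sum_(t : n.-tuple letter | sorted noRL t)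
  'X^(word_weight t).
Definition word_poly_after n c : {poly int} :=
  \sum_(t : n.-tuple letter | path noRL c t) 'X^(word_weight t).

Lemma big_tupleS (T : finType) (R : nmodType) n (P : pred (seq T)) (F : seq T -> R) :
  \sum_(t : n.+1.-tuple T | P t) F t =
  \sum_(c : T) \sum_(t : n.-tuple T | P (c :: t)) F (c :: t).
Proof.
rewrite pair_big_dep /=.
rewrite (reindex (fun p : T * n.-tuple T => [tuple of p.1 :: p.2])) //=.
exists (fun t : n.+1.-tuple T => (thead t, [tuple of behead t])) => [[c t] _|t _] /=.
  by congr pair; apply: val_inj.
by rewrite [RHS]tuple_eta; apply: val_inj.
Qed.

Lemma word_poly_afterS n c : word_poly_after n.+1 c =
  \sum_(d | noRL c d) 'X^(weight d) * word_poly_after n d.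
Proof.
rewrite /word_poly_after (big_tupleS _ _ n (path noRL c) (fun t =>
  'X^(word_weight t))) [RHS]big_mkcond.
apply: eq_bigr => d _ /=; case: noRL => /=; last by rewrite big_pred0.
by rewrite big_distrr; apply: eq_bigr => t _; rewrite /word_weight big_cons exprD.
Qed.

Lemma word_polyS n : word_poly n.+1 = \sum_d 'X^(weight d) * word_poly_after n d.
Proof.
rewrite /word_poly (big_tupleS _ _ n (sorted noRL) (fun t => 'X^(word_weight t))).
apply: eq_bigr => d _ /=.
by rewrite big_distrr; apply: eq_bigr => t _; rewrite /word_weight big_cons exprD.
Qed.

Lemma word_poly_after_notR n c : ~~ isR c -> word_poly_after n c = word_poly n.
Proof.
move=> cR; apply: eq_bigl => t; case: t => -[|d s] //= _.
by rewrite /noRL (negPf cR).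
Qed.

Lemma word_poly0 : word_poly 0 = 1.
Proof. by rewrite /word_poly (big_pred1 [tuple]) => [|t];
  rewrite ?/word_weight ?big_nil // tuple0. Qed.

Lemma word_poly_after0 c : word_poly_after 0 c = 1.
Proof. by rewrite /word_poly_after (big_pred1 [tuple]) => [|t];
  rewrite ?/word_weight ?big_nil // tuple0. Qed.

Lemma big_letter (F : letter -> {poly int}) : \sum_d F d =
  F (inl true) + F (inl false) + (F (inr (true, true)) + F (inr (true, false)) +
   (F (inr (false, true)) + F (inr (false, false)))).
Proof.
rewrite big_sumType /= big_bool /=; congr (_ + _).
rewrite (eq_bigr (fun p => F (inr (p.1, p.2)))) => [|[]//].
rewrite -(pair_bigA _ (fun a b => F (inr (a, b)))) /= big_bool /=.
by rewrite !big_bool.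
Qed.

Lemma word_poly_after_R n : word_poly_after n.+1 (inl true) = word_poly n.+1 - 'X * word_poly n.
Proof.
rewrite word_poly_afterS word_polyS big_mkcond !big_letter /= [word_poly_after n (inl
  false)]word_poly_after_notR //=.
by rewrite expr1; ring.
Qed.

Definition frag_poly : {poly int} := 2 * (1 + 'X + 'X^2).

Lemma word_poly1 : word_poly 1 = 'X * frag_poly.
Proof. by rewrite word_polyS big_letter !word_poly_after0 /frag_poly /=; ring. Qed.

Lemma word_polySS n : word_poly n.+2 = 'X * frag_poly * word_poly n.+1 - 'X^2 * word_poly n.
Proof.
rewrite word_polyS big_letter /= word_poly_after_R ![word_poly_after n.+1
  _]word_poly_after_notR // /frag_poly /=; ring.
Qed.

Definition cheb {R : comNzRingType} (y : R) n : R :=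
  \sum_(k < n.+1) (-1) ^+ k * 'C(n - k, k)%:R * y ^+ (n - 2 * k).

Lemma chebSS (R : comNzRingType) (y : R) n : cheb y n.+2 = y * cheb y n.+1 - cheb y n.
Proof.
rewrite /cheb big_ord_recl [in RHS]big_ord_recl /= !bin0 !subn0 !expr0.
rewrite big_ord_recr /= [X in _ + (_ + X)](_ : _ = 0); last first.
  by rewrite bin_small ?mulr0 ?mul0r //= /bump; lia.
rewrite mulrDr addr0 -addrA; congr (_ + _); first by rewrite !mulr1 !mul1r -exprS.
rewrite big_distrr /= -sumrB.
apply: eq_bigr => k _; rewrite /bump !add1n.
have lekn : (k <= n)%N by rewrite -ltnS.
have -> : (n.+2 - 2 * k.+1 = n - 2 * k)%N by lia.
have -> : (n.+2 - k.+1 = (n - k).+1)%N by lia.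
rewrite (subSS _ n) binS natrD exprS.
have [lt|le] := ltnP n (2 * k + 1).
  by rewrite (@bin_small _ k.+1); [ring|lia].
have -> : (n - 2 * k = (n.+1 - 2 * k.+1).+1)%N by lia.
by rewrite exprS; ring.
Qed.

Lemma word_poly_cheb n : word_poly n = 'X^n * cheb frag_poly n.
Proof.
suff: word_poly n = 'X^n * cheb frag_poly n /\ word_poly n.+1 =
  'X^(n.+1) * cheb frag_poly n.+1 by case.
elim: n => [|n [IH1 IH2]]; last first.
  by split=> //; rewrite word_polySS chebSS IH1 IH2 !exprS; ring.
split.
  by rewrite word_poly0 /cheb big_ord_recl big_ord0 /= bin0 !expr0 addr0 !mulr1.
rewrite word_poly1 /cheb big_ord_recl big_ord_recl big_ord0 /= /bump /= subnn bin0 addr0.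
by rewrite mulr0 mul0r addr0 expr0 !mul1r !expr1.
Qed.

Lemma sum_nat_widen (R : nmodType) a b N (G H : nat -> R) : (b <= N)%N ->
  (forall j, (a <= j < b)%N -> G j = H j) ->
  (forall j, (j < N)%N -> ~~ (a <= j < b)%N -> H j = 0) ->
  \sum_(a <= j < b) G j = \sum_(j < N) H j.
Proof.
move=> leb GH H0; rewrite -(big_mkord xpredT H) (eq_big_nat _ _ GH).
rewrite (big_nat_widen _ _ _ _ _ leb) (big_nat_widenl _ _ _ _ _ (leq0n a)) /=.
rewrite big_mkcond; apply: eq_big_nat => j /andP[_ ltj].
by case: ifPn => // jab; rewrite H0 // andbC.
Qed.

Lemma trinomial_pow (R : comNzRingType) (x : R) m L : (2 * m <= L)%N ->
  (1 + x + x ^+ 2) ^+ m =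
  \sum_(l < L.+1) \sum_((l + 1) %/ 2 <= j < l.+1) ('C(m, j) * 'C(j, l - j))%N%:R * x ^+ l.
Proof.
move=> leL.
pose g l j : R := if (j <= l)%N then ('C(m, j) * 'C(j, l - j))%N%:R * x ^+ l else 0.
rewrite [RHS](eq_bigr (fun l : 'I__ => \sum_(j < L.+1) g l j)) => [|l _]; last first.
  apply: sum_nat_widen => // j; rewrite /g.
    by case/andP=> _; rewrite ltnS => ->.
  move=> _; case: ifP => // jl jN; rewrite [X in (_ * X)%N]bin_small ?muln0 ?mul0r //; lia.
rewrite exchange_big /=.
have -> : 1 + x + x ^+ 2 = 1 + x * (1 + x) by ring.
rewrite exprDn.
rewrite -(big_mkord xpredT (fun j => 1 ^+ (m - j) * (x * (1 + x)) ^+ j *+ 'C(m, j))).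
apply: (@sum_nat_widen _ _ _ _ _ (fun j => \sum_(l < L.+1) g l j)); first lia.
  move=> j /andP[_ lejm]; rewrite expr1n mul1r exprMn exprDn.
  rewrite -(big_mkord xpredT (fun l => g l j)) (big_cat_nat (n := j)) //=; last lia.
  rewrite big_nat_cond [X in _ = X + _]big1 => [|l];
    last by rewrite /g => /andP[/andP[_ lt] _]; rewrite leqNgt lt.
  rewrite add0r -[X in \sum_(X <= _ < _) _]add0n big_addn big_distrr /= -sumrMnl.
  rewrite -(big_mkord xpredT (fun r => x ^+ j * (1 ^+ (j - r) * x ^+ r *+ 'C(j, r)) *+ 'C(m,
    j))).
  rewrite [RHS]big_mkord; apply: (@sum_nat_widen _ _ _ _ _ (fun r => g (r + j)%N j)).
    by lia.
    move=> r _; rewrite /g leq_addl addnK expr1n mul1r natrM exprD.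
    by rewrite -mulr_natl -[_ *+ 'C(j, r)]mulr_natl; ring.
  by move=> r _ H; rewrite /g leq_addl addnK [X in (_ * X)%N]bin_small ?muln0 ?mul0r //; lia.
move=> j _ H; apply: big1 => l _; rewrite /g bin_small ?mul0n ?mul0r ?if_same //; lia.
Qed.

Theorem theorem4p2 (n : nat) :
  Af (pyrene_edges n) =
  'X^n * \sum_(l < (2 * n).+1)
           \sum_((l + 2 * n + 3) %/ 4 <= i < n.+1)
             \sum_((l + 1) %/ 2 <= j < l.+1)
               ((-1) ^+ (n - i) *
                ((2 ^ (2 * i - n) * 'C(i, 2 * i - n) * 'C(2 * i - n, j)
                  * 'C(j, l - j))%N)%:R : int)%:P * 'X^l.
Proof.
rewrite Af_words -/(word_poly n) word_poly_cheb; congr (_ * _).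
rewrite /cheb (reindex_inj rev_ord_inj) /=.
pose c i : {poly int} := (-1) ^+ (n - i) * 'C(i, n - i)%:R * 2 ^+ (2 * i - n).
pose h l i : {poly int} := \sum_((l + 1) %/ 2 <= j < l.+1)
   ('C(2 * i - n, j) * 'C(j, l - j))%N%:R * 'X^l.
rewrite (eq_bigr (fun i : 'I_n.+1 => \sum_(l < (2 * n).+1) c i * h l i)) => [|i _].
  rewrite exchange_big; apply: eq_bigr => l _; apply/esym.
  apply: (@sum_nat_widen _ _ _ _ _ (fun i => c i * h l i)) => // i.
    case/andP=> lei ltin; rewrite big_distrr /=; apply: eq_bigr => j _.
    have -> : 'C(i, 2 * i - n) = 'C(i, n - i).
      by rewrite -bin_sub; [congr 'C(_, _)|]; lia.
    rewrite /c polyCM polyC_exp polyCN polyC1 !natrM !polyCM natrX polyC_exp.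
    by rewrite -!polyC_natr; ring.
  rewrite /c => ltin Hi; case: (ltnP (2 * i) n) => [lt|le].
    by rewrite bin_small ?mulr0 ?mul0r //; lia.
  rewrite /h big_nat_cond big1 ?mulr0 // => j /andP[/andP[j1 j2] _].
  by rewrite bin_small ?mul0n ?mul0r //; lia.
have lein : (i <= n)%N by rewrite -ltnS.
rewrite subSS -big_distrr /= -trinomial_pow; last lia.
rewrite /c /frag_poly exprMn subKn //.
have -> : (n - 2 * (n - i) = 2 * i - n)%N by lia.
ring.
Qed.
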